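(* Let $\Delta$ be a positive integer and let $\mathcal{C}$ be a class of graphs with maximum degree at most $\Delta$ closed under taking induced subgraphs. Let $t,N$ be integers, and let $X$ be a connected graph with $|V(X)|<t$. Let $\mathcal{F}$ be a set of graphs such that every $F\in\mathcal{F}$ is an $X$-forcer for $\mathcal{C}$. Let $\gamma(x)=1+\Delta+\Delta^2+\dots+\Delta^x$. If $\mathrm{tw}(H)<N$ for every $\mathcal{F}$-free graph $H$ in $\mathcal{C}$, then $\mathrm{tw}(G)\le 2N\gamma(t+1)^{\Delta^{t^2}\gamma(2t)+1}$ for every $G\in\mathcal{C}$.
   Context: $\mathrm{tw}$ is treewidth. For a graph $G$, $N[Z]$ denotes the closed neighbourhood of $Z\subseteq V(G)$ (i.e. $Z$ together with all vertices having a neighbour in $Z$). For disjoint $X',Y\subseteq V(G)$, $X'$ breaks $Y$ if for every connected component $D$ of $G\setminus N[X']$ we have $Y\not\subseteq N[D]$. A graph $F$ is an $X$-forcer for $G$ if for every $Y\subseteq V(G)$ inducing a graph isomorphic to $F$, there exists $X'\subset Y$ inducing a graph isomorphic to $X$ such that $X'$ breaks $Y\setminus X'$; $F$ is an $X$-forcer for a class $\mathcal{C}$ if it is an $X$-forcer for every $G\in\mathcal{C}$. A graph is $\mathcal{F}$-free if it has no induced subgraph isomorphic to a member of $\mathcal{F}$. *)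

(* Defs.v *)
From mathcomp Require Import all_boot all_order all_algebra.
From mathcomp Require Import boolp.

Set Implicit Arguments.
Unset Strict Implicit.
Unset Printing Implicit Defensive.

(* Finite simple graphs; the null graph (no vertices) is allowed. *)
Record sgraph := SGraph {
  vertex :> finType;
  adj : rel vertex;
  adj_sym : symmetric adj;
  adj_irrefl : irreflexive adj
}.

Section Induced.
Variables (G : sgraph) (S : {set G}).

Definition induced_adj : rel {x : G | x \in S} :=
  fun x y => adj (val x) (val y).

Lemma induced_adj_sym : symmetric induced_adj.
Proof. by move=> x y; apply: adj_sym. Qed.

Lemma induced_adj_irrefl : irreflexive induced_adj.
Proof. by move=> x; apply: adj_irrefl. Qed.

Definition induced : sgraph := SGraph induced_adj_sym induced_adj_irrefl.
End Induced.

Definition isomorphic (G H : sgraph) : Prop :=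
  exists2 f : G -> H, bijective f & {mono f : x y / adj x y}.

Definition max_degree (G : sgraph) : nat :=
  \max_(v : G) #|[set w : G | adj v w]|.

(* The null graph is not connected. *)
Definition connected (G : sgraph) : bool :=
  (0 < #|G|) && [forall x : G, forall y : G, connect (@adj G) x y].

Definition acyclic (G : sgraph) : Prop :=
  forall c : seq G, uniq c -> 2 < size c -> ~~ cycle (@adj G) c.

Definition is_tree (G : sgraph) : Prop := connected G /\ acyclic G.

Definition tree_decomposition (G T : sgraph) (B : T -> {set G}) : Prop :=
  [/\ is_tree T,
      forall v : G, exists t : T, v \in B t,
      forall u v : G, adj u v -> exists t : T, (u \in B t) && (v \in B t) &
      forall v : G, connected (induced [set t : T | v \in B t])].

Definition has_decomposition (G : sgraph) (k : nat) : Prop :=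
  exists (T : sgraph) (B : T -> {set G}),
    tree_decomposition B /\ \max_(t : T) #|B t| = k.

Lemma has_decomposition_ex (G : sgraph) :
  exists k, `[< has_decomposition G k >].
Proof.
have e_sym : symmetric (fun _ _ : unit => false) by [].
have e_irr : irreflexive (fun _ _ : unit => false) by [].
pose T := SGraph e_sym e_irr; pose B (_ : T) : {set G} := [set: G].
exists (\max_(t : T) #|B t|); apply/asboolP; exists T, B; split=> //.
split=> [|v|u v _|v].
- split; last by case=> [|[] [|[] []]].
  rewrite /connected card_unit /=.
  by apply/forallP=> -[]; apply/forallP=> -[]; apply: connect0.
- by exists tt; rewrite inE.
- by exists tt; rewrite !inE.
- have tP : (tt : T) \in [set t : T | v \in B t] by rewrite !inE.
  apply/andP; split; first by apply/card_gt0P; exists (exist _ (tt : T) tP).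
  apply/forallP=> x; apply/forallP=> y.
  suff -> : x = y by apply: connect0.
  by apply: val_inj; case: (val x); case: (val y).
Qed.

(* The width is the largest bag size minus one, as an integer: the null graph
   has treewidth -1. *)
Definition tw (G : sgraph) : int :=
  ((ex_minn (has_decomposition_ex G))%:Z - 1)%R.

Definition closed_nbhd (G : sgraph) (Z : {set G}) : {set G} :=
  Z :|: [set v : G | [exists z in Z, adj v z]].

(* [component Z D]: D is (the vertex set of) a connected component of G \ Z. *)
Definition component (G : sgraph) (Z D : {set G}) : bool :=
  maxset (fun A : {set G} => (A \subset ~: Z) && connected (induced A)) D.

Definition breaks (G : sgraph) (X' Y : {set G}) : Prop :=
  forall D : {set G},
    component (closed_nbhd X') D -> ~~ (Y \subset closed_nbhd D).

Definition forcer (X F G : sgraph) : Prop :=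
  forall Y : {set G}, isomorphic (induced Y) F ->
    exists X' : {set G},
      [/\ X' \proper Y, isomorphic (induced X') X & breaks X' (Y :\: X')].

Definition class_forcer (X F : sgraph) (C : sgraph -> Prop) : Prop :=
  forall G : sgraph, C G -> forcer X F G.

Definition graph_free (F : sgraph -> Prop) (G : sgraph) : Prop :=
  forall (H : sgraph) (S : {set G}), F H -> ~ isomorphic (induced S) H.

(* No closure under isomorphism is assumed, only under passing to the graphs
   [induced S] themselves. *)
Definition hereditary (C : sgraph -> Prop) : Prop :=
  forall (G : sgraph) (S : {set G}), C G -> C (induced S).

Definition gamma (Delta x : nat) : nat := \sum_(i < x.+1) Delta ^ i.

(* Main.v *)
Require Import Defs.
From mathcomp Require Import all_boot all_order all_algebra.
From mathcomp Require Import boolp zify.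

(* For a weight w on the vertices of G, call Z balanced if every connected set
   avoiding Z has at most half of the weight. Graphs of treewidth < N have
   balanced sets of size N (a bag, by the Helly property of subtrees), and
   balanced sets of size d for all weights yield tw <= 3d.
   Take the induced copies S of X one after the other. If N[S] is not balanced
   in the current vertex set b, let D be the heavy component of b \ N[S],
   replace b by its part inside N[D] and S, and move the deleted weight to a
   vertex of S. In the end no copy S of X inside b breaks (in G) a subset of
   b \ S, so b induces an F-free graph and has a balanced set of size N.
   Undoing one step adds N[S] to the balanced set only if that set meets S.
   Colour the copies so that N[S] misses S' for distinct S, S' of one colour,
   and treat the colours one by one: each colour then enlarges the balanced
   set by a factor of at most max |N[S]|. The number of colours is bounded by
   counting the walks that cover a copy. *)

Set Implicit Arguments.
Unset Strict Implicit.
Unset Printing Implicit Defensive.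

(** * Connected sets and the Helly property of subtrees *)

Section Connectivity.
Variable G : sgraph.
Implicit Types (A B E S : {set G}) (x y z : G).

(** Reflexive also at vertices outside [A], so membership in [A] has to be supplied at one end, as
    in [conn_mem]. *)
Definition conn A : rel G := connect [rel x y | [&& x \in A, y \in A & adj x y]].

(** The empty set qualifies here, whereas [connected] excludes the null graph. *)
Definition connset A : Prop := {in A &, forall x y, conn A x y}.

Lemma conn0 A x : conn A x x.
Proof. exact: connect0. Qed.

Lemma conn_sym A x y : conn A x y = conn A y x.
Proof.
apply: sym_connect_sym => u v /=.
by rewrite adj_sym andbCA.
Qed.

Lemma conn_trans A : transitive (conn A).
Proof. exact: connect_trans. Qed.

Lemma conn1 A x y : x \in A -> y \in A -> adj x y -> conn A x y.
Proof. by move=> xA yA xy; apply: connect1 => /=; rewrite xA yA. Qed.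

Lemma conn_sub A B x y : A \subset B -> conn A x y -> conn B x y.
Proof.
move=> /subsetP sAB; apply: connect_sub => u v /= /and3P[uA vA uv].
by apply: conn1; rewrite ?sAB.
Qed.

Lemma conn_closed A B x y :
  (forall u v, u \in B -> u \in A -> v \in A -> adj u v -> v \in B) ->
  conn A x y -> x \in B -> y \in B.
Proof.
move=> clB /connectP[p + ->]; elim: p x => //= z p IH x.
move=> /andP[/and3P[xA zA xz] pzp] xB.
by apply: IH pzp _; apply: clB xz.
Qed.

Lemma conn_mem A x y : conn A x y -> x \in A -> y \in A.
Proof. by apply: conn_closed => u v. Qed.

(** Follow a walk in [E] up to the first edge that leaves [B]; the part before it stays in
    [E :&: B]. *)
Lemma conn_exit E B x y :
  conn E x y -> x \in E -> x \in B -> y \notin B ->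
  exists u v, [/\ conn (E :&: B) x u, u \in E :&: B, v \in E :\: B & adj u v].
Proof.
move=> /connectP[p + ->]; elim: p x => /= [x _ _ -> //|z p IH x].
move=> /andP[/and3P[xE zE xz] pzp] _ xB yB.
case: (boolP (z \in B)) => zB.
  have [u [v [zu uEB vEB uv]]] := IH z pzp zE zB yB.
  exists u, v; split=> //; apply: conn_trans zu.
  by apply: conn1; rewrite // inE ?xE ?zE ?xB.
by exists x, z; split; rewrite ?inE ?xE ?zB ?xB //; apply: connect0.
Qed.

(** A shortened walk never returns to its starting point. *)
Lemma conn_avoid A x y :
  conn A x y -> x != y -> exists2 z, adj x z & z \in A /\ conn (A :\ x) z y.
Proof.
move=> /connectP[p pP ->]; case/shortenP: pP => [[|z q]] /=.
  by rewrite eqxx.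
move=> /andP[/and3P[xA zA xz]] pzq /andP[xq zq] _ _; exists z => //; split=> //.
apply/connectP; exists q => //.
elim: q z xq {zA xz zq} pzq => //= u q IH z.
move=> xzq /andP[/and3P[zA uA zu] puq].
move: xzq; rewrite !inE !negb_or => /and3P[xz xu xq].
by rewrite ![_ == x]eq_sym xz xu zA uA zu IH // inE negb_or xu.
Qed.

Lemma connset_component A x : x \in A -> connset [set y | conn A x y].
Proof.
move=> xA; suff H y : conn A x y -> conn [set y | conn A x y] x y.
  move=> y z; rewrite !inE => /H xy /H xz.
  by apply: conn_trans xz; rewrite conn_sym.
set C := [set y | conn A x y] => xy.
suff: y \in [set z in A | conn C x z] by rewrite inE => /andP[].
apply: conn_closed xy _; last by rewrite inE xA conn0.
move=> u v; rewrite !inE => /andP[uA xu] _ vA uv; rewrite vA.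
have uC : u \in C by apply: conn_mem xu _; rewrite inE conn0.
apply: (conn_trans xu).
apply: conn1 => //; move: uC; rewrite !inE => /conn_trans; apply.
exact: conn1.
Qed.

Lemma connected_inducedP A :
  reflect (A != set0 /\ connset A) (connected (induced A)).
Proof.
apply: (iffP andP) => [[n0 /forallP cA]|[n0 cA]]; split.
- case/card_gt0P: n0 => -[x xA] _; by apply/set0Pn; exists x.
- suff H (u v : induced A) : connect (@adj (induced A)) u v -> conn A (val u) (val v).
    move=> x y xA yA.
    have /forallP/(_ (exist _ y yA)) := cA (exist _ x xA); exact: H.
  move=> /connectP[p + ->]; elim: p u => /= [u _|z p IH u]; first exact: conn0.
  move=> /andP[uz pz]; apply: conn_trans (IH z pz).
  by apply: conn1; [exact: (valP u)|exact: (valP z)|].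
- case/set0Pn: n0 => x xA; apply/card_gt0P; by exists (exist _ x xA).
- apply/forallP=> -[x xA]; apply/forallP=> -[y yA].
  have /connectP[p pP ey] := cA _ _ xA yA.
  elim: p x xA pP ey => /= [x xA _ ey|z p IH x xA].
    have -> : exist (fun z => is_true (z \in A)) y yA = exist _ x xA
      by apply: val_inj.
    exact: connect0.
  move=> /andP[/and3P[_ zA xz] pzp] ey.
  by apply: connect_trans (IH z zA pzp ey); apply: connect1.
Qed.

Lemma mem_closed_nbhd A x : x \in A -> x \in closed_nbhd A.
Proof. by rewrite inE => ->. Qed.

Lemma closed_nbhdP A x :
  reflect (x \in A \/ exists2 y, y \in A & adj x y) (x \in closed_nbhd A).
Proof.
rewrite !inE; apply: (iffP orP) => -[-> |H]; try by left.
  by case/exists_inP: H => y yA xy; right; exists y.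
by case: H => y yA xy; right; apply/exists_inP; exists y.
Qed.

Lemma closed_nbhdS A B : A \subset B -> closed_nbhd A \subset closed_nbhd B.
Proof.
move=> /subsetP sAB; apply/subsetP => x /closed_nbhdP[/sAB|[y /sAB yB xy]].
  exact: mem_closed_nbhd.
by apply/closed_nbhdP; right; exists y.
Qed.

End Connectivity.

Lemma connectedP (G : sgraph) :
  reflect (0 < #|G| /\ forall x y : G, conn setT x y) (connected G).
Proof.
have E x y : conn setT x y = connect (@adj G) x y.
  by apply: eq_connect => u v /=; rewrite !inE.
apply: (iffP andP) => -[n0 H]; split=> //.
  by move=> x y; rewrite E; move/forallP/(_ x)/forallP/(_ y): H.
by apply/forallP=> x; apply/forallP=> y; rewrite -E.
Qed.

Section Helly.
Variable T : sgraph.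
Hypothesis treeT : is_tree T.

(** Otherwise a path from [u] to [s] avoiding [t] closes up through [t] to a cycle. *)
Lemma tree_nbr_unique (t s u : T) :
  adj t s -> adj t u -> conn [set~ t] u s -> s = u.
Proof.
move=> ts tu us; apply/eqP/negPn/negP => nsu.
case/connectP: us => p pP es; case/shortenP: pP es => q qP uq _ es.
have tNq : t \notin u :: q.
  apply/negP; rewrite inE => /orP[/eqP e|].
    by move: tu; rewrite e adj_irrefl.
  elim: q {tu es uq} (u) qP => //= a q IH b /andP[/and3P[_ H _] pa].
  rewrite inE => /orP[/eqP e|]; last exact: IH pa.
  by move: H; rewrite e !inE eqxx.
case: treeT => _ /(_ (t :: u :: q)); rewrite cons_uniq tNq uq => /(_ isT).
case: q qP es {uq tNq} => [|a q] qP /= es; first by rewrite es eqxx in nsu.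
move/(_ isT)/negP; apply; rewrite tu rcons_path /=.
have -> : adj (last a q) t by rewrite -es adj_sym.
rewrite andbT; have : path (@adj T) u (a :: q).
  by apply: sub_path qP => x y /and3P[].
by [].
Qed.

(** Infinite descent. If every node [t] is missed by some member [S], then [S] lies in one component
    of [T] minus [t]. Stepping from [t] to its neighbour [s] in that component and taking a member
    that misses [s] leads to a strictly smaller component. *)
Lemma helly_subtrees (P : {set T} -> Prop) :
  (forall S, P S -> connset S) ->
  (forall S S', P S -> P S' -> exists2 x, x \in S & x \in S') ->
  exists t, forall S, P S -> t \in S.
Proof.
move=> cP iP; apply: contrapT => nt.
have nt' t : exists2 S, P S & t \notin S.
  apply: contrapT => H; apply: nt; exists t => S PS.
  by apply/negPn/negP => tS; apply: H; exists S.
have [/connectedP[T0 cT] _] := treeT.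
pose C (t x : T) := [set y | conn [set~ t] x y].
suff no n : forall t x S, P S -> t \notin S -> x \in S -> ~ #|C t x| <= n.
  case/card_gt0P: T0 => t _; have [S PS tS] := nt' t.
  have [x xS _] := iP S S PS PS; exact: (no _ t x S PS tS xS (leqnn _)).
elim: n => [|n IH] t x S PS tS xS.
  rewrite leqn0 cards_eq0 => /eqP/setP/(_ x).
  by rewrite !inE conn0.
move=> Cn; have tx : t != x by apply: contraNneq tS => ->.
have [s ts [_ sx]] := conn_avoid (cT t x) tx.
rewrite setTD in sx.
have [S' PS' sS'] := nt' s.
have [y yS yS'] := iP S S' PS PS'.
apply: (IH s y S' PS' sS' yS').
have xy : conn [set~ t] x y.
  apply: conn_sub (cP _ PS _ _ xS yS).
  by apply/subsetP => z zS; rewrite !inE; apply: contraNneq tS => <-.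
have ys : y != s by apply: contraNneq sS' => <-.
(* A walk from [t] to [y] avoiding [s] would start at a neighbour of [t] other than [s], yet joined
   to [s] off [t] through [y] and [x]. *)
have tC : t \notin C s y.
  rewrite inE conn_sym; apply/negP => ty.
  have /(conn_avoid ty)[u tu [us uy]] : t != y.
    by apply: contraNneq tS => ->.
  have eus : s = u.
    apply: (tree_nbr_unique ts tu).
    have {}uy : conn [set~ t] u y.
      by apply: conn_sub uy; apply/subsetP => z; rewrite !inE => /andP[].
    apply: (conn_trans uy); apply: (@conn_trans _ _ x); rewrite conn_sym //.
  by move: us; rewrite eus !inE eqxx.
rewrite -ltnS; apply: leq_trans Cn; apply: proper_card.
apply/properP; split; last first.
  exists s; rewrite !inE; first by rewrite conn_sym.
  apply/negP => /conn_mem; rewrite !inE eqxx => H.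
  by move: H; rewrite ys => /(_ isT).
apply/subsetP => z zC; rewrite inE; apply: (conn_trans xy).
have /(connset_component)/(_ y z) : y \in [set~ s].
  by rewrite !inE ys.
rewrite inE conn0 => /(_ isT zC); apply: conn_sub.
apply/subsetP => v vC; rewrite !inE; apply: contraNneq tC => <-; exact: vC.
Qed.

End Helly.

Definition weight (G : sgraph) (w : G -> nat) (A : {set G}) := \sum_(x in A) w x.

(** [Z] is not confined to [b]: the sets N[S] added to it later are neighbourhoods in all of [G]. *)
Definition balanced (G : sgraph) (b : {set G}) (w : G -> nat) (Z : {set G}) :=
  forall E : {set G}, connset E -> E \subset b -> [disjoint E & Z] ->
    2 * weight w E <= weight w b.

Section Weight.
Variables (G : sgraph) (w : G -> nat).
Implicit Types A B : {set G}.

Lemma weightS A B : A \subset B -> weight w A <= weight w B.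
Proof.
move=> sAB; rewrite /weight [leqRHS](big_setID A) /= (setIidPr sAB).
exact: leq_addr.
Qed.

Lemma weightU A B : [disjoint A & B] -> weight w (A :|: B) = weight w A + weight w B.
Proof.
by move=> dAB; rewrite /weight (eq_bigl _ _ (fun x => in_setU x A B)) bigU.
Qed.

End Weight.

(** * Balanced sets and treewidth *)

(** The subtrees of two adjacent vertices share a node, so walking through [E] links the subtrees of
    its vertices. *)
Lemma connset_bags (G T : sgraph) (B : T -> {set G}) (E : {set G}) :
  tree_decomposition B -> connset E ->
  connset [set t | ~~ [disjoint B t & E]].
Proof.
case=> _ _ eB cB cE; set S := [set t | _].
have cv v t s : v \in E -> v \in B t -> v \in B s -> conn S t s.
  move=> vE vt vs; have /connected_inducedP[_ cv] := cB v.
  have: conn [set t | v \in B t] t s by apply: cv; rewrite inE.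
  apply: conn_sub; apply/subsetP => r; rewrite !inE => vr.
  by apply/pred0Pn; exists v; rewrite /= vr.
move=> t s; rewrite !inE => /pred0Pn[v /andP[/= vt vE]] /pred0Pn[u /andP[/= us uE]].
(* The invariant along a walk in [E]: every bag containing the current vertex can be reached from
   [t]. *)
pose C := [set z | [forall r, (z \in B r) ==> conn S t r]].
suff: u \in C by rewrite inE => /forallP/(_ s)/implyP; apply.
apply: conn_closed (cE v u vE uE) _; last first.
  by rewrite inE; apply/forallP => r; apply/implyP; apply: cv.
move=> x y; rewrite !inE => /forallP xC xE yE /eB[r /andP[xr yr]].
apply/forallP => q; apply/implyP => yq.
by apply: conn_trans (implyP (xC r) xr) (cv y r q yE yr yq).
Qed.

(** Two connected sets, each with more than half of the weight, intersect, so their subtrees of bags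
    share a node. By the Helly property one bag meets all these heavy sets. *)
Lemma tw_balanced (G : sgraph) (n : nat) (w : G -> nat) :
  (tw G < n%:Z)%R -> exists2 Z : {set G}, #|Z| <= n & balanced setT w Z.
Proof.
rewrite /tw; case: ex_minnP => k /asboolP[T [B [tdB <-]]] _ kn.
have {kn} Bn t : #|B t| <= n.
  have : \max_(t : T) #|B t| <= n by lia.
  by apply: leq_trans; apply: leq_bigmax_cond.
have treeT : is_tree T by case: tdB.
pose heavy E := connset E /\ weight w setT < 2 * weight w E.
pose P S := exists2 E, heavy E & S = [set t | ~~ [disjoint B t & E]].
have [t tP] : exists t, forall S, P S -> t \in S.
  apply: helly_subtrees => // [S [E [cE _] ->]|S S' [E [cE wE] ->] [E' [cE' wE'] ->]].
    exact: connset_bags.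
  have /pred0Pn[v /andP[/= vE vE']] : ~~ [disjoint E & E'].
    apply/negP => /(weightU w) e; have := weightS w (subsetT (E :|: E')).
    lia.
  have [_ /(_ v)[t vt] _ _] := tdB.
  by exists t; rewrite inE; apply/pred0Pn; exists v; rewrite /= vt.
exists (B t) => // E cE _ dE; rewrite leqNgt; apply/negP => wE.
have /tP : P [set t | ~~ [disjoint B t & E]] by exists E.
by rewrite inE disjoint_sym dE.
Qed.

Definition top_index (G : sgraph) (p : nat -> nat) (B : nat -> {set G}) v i :=
  (v \in B i) && ((i == 0) || (v \notin B (p i))).

(* Tree decomposition of the subgraph induced by A: the tree lives on the
   indices below n, p sends a node to its parent, and the root bag contains R.
   The bags of v form a subtree iff exactly one of them is not below another. *)
Record rooted_decomposition (G : sgraph) (k : nat) (A R : {set G})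
    (n : nat) (p : nat -> nat) (B : nat -> {set G}) : Prop := {
  rd_pos : 0 < n;
  rd_parent : forall i, 0 < i < n -> p i < i;
  rd_card : forall i, i < n -> #|B i| <= k;
  rd_root : R \subset B 0;
  rd_sub : forall i, i < n -> B i \subset A;
  rd_cover : forall v, v \in A -> exists2 i, i < n & v \in B i;
  rd_edge : forall u v, u \in A -> v \in A -> adj u v ->
    exists2 i, i < n & (u \in B i) && (v \in B i);
  rd_top : forall v i j, i < n -> j < n ->
    top_index p B v i -> top_index p B v j -> i = j }.

Definition decomposable (G : sgraph) (k : nat) (A R : {set G}) : Prop :=
  exists n p B, rooted_decomposition k A R n p B.

(** * Trees given by a parent function *)

Section ParentTree.
Variables (n : nat) (p : nat -> nat).
Hypothesis n_gt0 : 0 < n.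
Hypothesis p_lt : forall i, 0 < i < n -> p i < i.

(** The guards [0 < i] and [0 < j] discard the meaningless value [p 0] at the root. *)
Definition parent_adj : rel 'I_n :=
  fun i j => (0 < i) && (p i == j) || (0 < j) && (p j == i).

Lemma parent_adj_sym : symmetric parent_adj.
Proof. by move=> i j; rewrite /parent_adj orbC. Qed.

Lemma parent_adj_irrefl : irreflexive parent_adj.
Proof.
move=> i; rewrite /parent_adj orbb; apply/negP => /andP[i0 /eqP e].
by have := p_lt (i := i); rewrite i0 ltn_ord e ltnn => /(_ isT).
Qed.

Definition parent_graph := SGraph parent_adj_sym parent_adj_irrefl.

Lemma parent_adj_le (i j : 'I_n) : parent_adj i j -> j <= i -> p i = j.
Proof.
case/orP=> /andP[i0 /eqP //] e ji.
by have := p_lt (i := j); rewrite i0 ltn_ord e ltnNge ji => /(_ isT).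
Qed.

(** Both neighbours of the largest node on a cycle are smaller, hence both are its parent, but they
    are distinct. *)
Lemma parent_graph_acyclic : acyclic parent_graph.
Proof.
move=> c uc sc; apply/negP => cc.
have [m mc mmax] : exists2 m : 'I_n, m \in c & forall j : 'I_n, j \in c -> j <= m.
  case: c sc {uc cc} => // a c _; have ac : a \in a :: c by rewrite mem_head.
  exists [arg max_(i > (a : 'I_n) in (a :: c)) (i : nat)].
    by case: arg_maxnP.
  by case: arg_maxnP => // i ic mi j jc; apply: mi.
have [k c' ec] := rot_to mc.
have mmax' j : j \in m :: c' -> j <= m by rewrite -ec mem_rot; apply: mmax.
move: uc sc cc; rewrite -(rot_uniq k) -(size_rot k) -(rot_cycle k) ec.
case: c' {ec} mmax' => [|a [|b c']] //= mmax' /and3P[_ ac _] _.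
move=> /and3P[ma _]; rewrite rcons_path => /andP[_]; rewrite parent_adj_sym => lm.
have := parent_adj_le ma (mmax' _ _); rewrite !inE eqxx orbT => /(_ isT) e1.
have lc : last b c' \in b :: c' by apply: mem_last.
have := parent_adj_le lm (mmax' _ _); rewrite 2!in_cons lc !orbT => /(_ isT) e2.
by move: ac; rewrite (_ : a = last b c') ?lc //; apply: val_inj; rewrite /= -e1.
Qed.

(** Climbing to parents inside [S] ends at a node that is the root or whose parent is outside [S];
    by hypothesis there is only one such node, so all climbs meet. The quantifier over [q] turns the
    number [p i] into a node. *)
Lemma parent_connset (S : {set parent_graph}) :
  (forall i j : 'I_n, i \in S -> j \in S ->
     ((i : nat) = 0 \/ forall q : 'I_n, p i = q -> q \notin S) ->
     ((j : nat) = 0 \/ forall q : 'I_n, p j = q -> q \notin S) -> i = j) ->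
  connset S.
Proof.
move=> uS.
have H m : forall i : 'I_n, i <= m -> i \in S -> exists2 r : 'I_n, conn S i r &
    r \in S /\ ((r : nat) = 0 \/ forall q : 'I_n, p r = q -> q \notin S).
  elim: m => [|m IH] i im iS.
    exists i; first exact: conn0.
    by split=> //; left; apply/eqP; rewrite -leqn0.
  case: (posnP i) => i0; first by exists i; [exact: conn0 | split=> //; left].
  have pi : p i < i by apply: p_lt; rewrite i0 ltn_ord.
  pose q := Ordinal (ltn_trans pi (ltn_ord i)).
  case: (boolP (q \in S)) => qS.
    have [|r qr rS] := IH q _ qS; first by rewrite -ltnS (leq_trans pi).
    exists r => //; apply: conn_trans qr; apply: conn1 => //=.
    by rewrite /parent_adj i0 eqxx.
  exists i; first exact: conn0.
  split=> //; right => q' eq'; suff -> : q' = q by [].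
  by apply: val_inj.
move=> i j iS jS.
have [r ir [rS rt]] := H i i (leqnn i) iS.
have [s js [sS st]] := H j j (leqnn j) jS.
by apply: (conn_trans ir); rewrite (uS r s rS sS rt st) conn_sym.
Qed.

Lemma parent_graph_tree : is_tree parent_graph.
Proof.
split; last exact: parent_graph_acyclic.
apply/connectedP; split; first by rewrite card_ord.
have H : connset [set: parent_graph].
  apply: parent_connset => i j _ _ Hi Hj; apply: val_inj => /=.
  suff H k : (k : 'I_n) = 0 :> nat \/ (forall q : 'I_n, p k = q -> q \notin [set: parent_graph]) -> k = 0 :> nat.
    by rewrite (H _ Hi) (H _ Hj).
  case=> // H; case: (posnP k) => // k0.
  have pk : p k < k by apply: p_lt; rewrite k0 ltn_ord.
  by have := H (Ordinal (ltn_trans pk (ltn_ord k))) erefl; rewrite inE.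
by move=> x y; apply: H; rewrite inE.
Qed.

End ParentTree.

Lemma decomposable_tw (G : sgraph) (k : nat) (R : {set G}) :
  decomposable k.+1 setT R -> (tw G <= k%:Z)%R.
Proof.
case=> n [p [B [n0 pP cB _ _ vB eB tB]]].
rewrite /tw; case: ex_minnP => m _ H; move: H (H (\max_(t : parent_graph pP) #|B (t : 'I_n)|)) => _ H.
suff : m <= k.+1 by lia.
  apply: leq_trans (H _) _; last by apply/bigmax_leqP => i _; exact: cB.
  apply/asboolP; exists (parent_graph pP), (fun t : 'I_n => B t); split=> //.
  split=> [|v|u v uv|v].
  - exact: parent_graph_tree.
  - have [i ni vi] := vB v (in_setT v); by exists (Ordinal ni).
  - have [i ni vi] := eB u v (in_setT u) (in_setT v) uv; by exists (Ordinal ni).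
  - apply/connected_inducedP; split.
      have [i ni vi] := vB v (in_setT v); apply/set0Pn.
      by exists (Ordinal ni); rewrite inE.
    apply: parent_connset => i j iS jS Hi Hj; apply: val_inj => /=.
    suff H' q : q \in [set t : parent_graph pP | v \in B (t : 'I_n)] ->
      (q : 'I_n) = 0 :> nat \/ (forall r : 'I_n, p q = r -> r \notin [set t : parent_graph pP | v \in B (t : 'I_n)]) ->
      top_index p B v (q : 'I_n).
      by apply: (tB v); rewrite ?ltn_ord //; apply: H'.
    rewrite /top_index inE => -> [-> //|Hq]; apply/orP.
    case: (posnP (q : 'I_n)) => [-> //|q0]; first by left.
    right; have pq : p q < (q : 'I_n) by apply: (pP q); rewrite q0 ltn_ord.
    by have := Hq (Ordinal (ltn_trans pq (ltn_ord q))) erefl; rewrite inE.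
Qed.

(** * Gluing rooted decompositions at their roots *)

Section Glue.
Variables (G : sgraph) (k : nat).
Implicit Types A R : {set G}.

Lemma decomposable_bag A : #|A| <= k -> decomposable k A A.
Proof.
move=> cA; exists 1, id, (fun _ => A); split=> //.
- by case.
- by move=> v; exists 0.
- by move=> u v uA vA _; exists 0; rewrite ?uA.
- by move=> v [|i] [|j].
Qed.

Lemma decomposable_root A R R' : R' \subset R -> decomposable k A R -> decomposable k A R'.
Proof.
move=> sR [n [p [B [n0 pP cB rB sB vB eB tB]]]]; exists n, p, B; split=> //.
exact: subset_trans rB.
Qed.

(** Hang the second tree below the root of the first. Common vertices lie in both root bags, so
    their two subtrees are joined by the new edge. *)
Lemma decomposable_glue A1 R1 A2 R2 :
  decomposable k A1 R1 -> decomposable k A2 R2 ->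
  A1 :&: A2 \subset R1 -> A1 :&: A2 \subset R2 ->
  (forall u v, u \in A1 -> v \in A2 -> adj u v -> (u \in A2) || (v \in A1)) ->
  decomposable k (A1 :|: A2) R1.
Proof.
move=> [n1 [p1 [B1 [n10 pP1 cB1 rB1 sB1 vB1 eB1 tB1]]]].
move=> [n2 [p2 [B2 [n20 pP2 cB2 rB2 sB2 vB2 eB2 tB2]]]] /subsetP s1 /subsetP s2 noE.
(* Nodes of the second tree are shifted by [n1]; its root becomes node [n1], with parent 0. *)
pose p i := if i < n1 then p1 i else if i == n1 then 0 else n1 + p2 (i - n1).
pose B i := if i < n1 then B1 i else B2 (i - n1).
have Bl i : i < n1 -> B i = B1 i by rewrite /B => ->.
have Br i : B (n1 + i) = B2 i by rewrite /B ltnNge leq_addr /= addKn.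
have pr j : p (n1 + j) = if j == 0 then 0 else n1 + p2 j.
  by rewrite /p ltnNge leq_addr /= -{2}[n1]addn0 eqn_add2l addKn.
have splitI i : i < n1 + n2 -> i < n1 \/ exists2 j, j < n2 & i = n1 + j.
  move=> H; case: (ltnP i n1) => h; [by left|right; exists (i - n1); lia].
have topl v i : i < n1 -> top_index p B v i -> top_index p1 B1 v i.
  move=> h; rewrite /top_index Bl // /p h => /andP[-> /=].
  case: (posnP i) => [-> //|i0]; rewrite Bl //.
  by apply: (ltn_trans (pP1 i _) h); rewrite i0.
(* A vertex of [A1] in the second tree lies in both root bags. So its topmost node there would be
   the root, but the parent bag of that root contains it as well. *)
have topr v j : j < n2 -> top_index p B v (n1 + j) -> top_index p2 B2 v j /\ v \notin A1.
  move=> h; rewrite /top_index Br addn_eq0 eqn0Ngt n10 /= => /andP[vj].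
  have vA2 : v \in A2 by apply: subsetP (sB2 _ h) _ vj.
  have vA1 : v \in A1 -> v \in B1 0 /\ v \in B2 0.
    move=> vA1; split; [apply: (subsetP rB1)|apply: (subsetP rB2)].
      by apply: s1; rewrite inE vA1.
    by apply: s2; rewrite inE vA1.
  rewrite vj pr.
  case: (posnP j) => [->|j0] /=.
    rewrite Bl // => v0; split=> //; apply/negP => /vA1[].
    by rewrite (negPf v0).
  rewrite Br => vp; split=> //; apply/negP => /vA1[_ v0].
  have := tB2 v j 0 h n20; rewrite /top_index vj vp v0 orbT => /(_ isT isT) e.
  by rewrite e in j0.
exists (n1 + n2), p, B; split.
- lia.
- move=> i /andP[i0 /splitI[h|[j h e]]].
    by rewrite /p h; apply: (pP1 i); rewrite i0.
  subst i; rewrite pr.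
  case: (posnP j) => [|j0] //.
  by rewrite ltn_add2l; apply: pP2; rewrite j0.
- by move=> i /splitI[h|[j h ->]]; rewrite ?Br ?Bl ?cB1 ?cB2.
- by rewrite Bl.
- move=> i /splitI[h|[j h ->]]; rewrite ?Br ?Bl //.
    by apply: subset_trans (sB1 _ h) _; apply: subsetUl.
  by apply: subset_trans (sB2 _ h) _; apply: subsetUr.
- move=> v; rewrite inE => /orP[/vB1|/vB2][i h vi].
    by exists i; rewrite ?Bl //; lia.
  by exists (n1 + i); rewrite ?Br //; lia.
- have E1 u v : u \in A1 -> v \in A1 -> adj u v ->
    exists2 i, i < n1 + n2 & (u \in B i) && (v \in B i).
    move=> uA vA uv; have [i h vi] := eB1 u v uA vA uv.
    by exists i; rewrite ?Bl //; lia.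
  have E2 u v : u \in A2 -> v \in A2 -> adj u v ->
    exists2 i, i < n1 + n2 & (u \in B i) && (v \in B i).
    move=> uA vA uv; have [i h vi] := eB2 u v uA vA uv.
    by exists (n1 + i); rewrite ?Br //; lia.
  move=> u v; rewrite !inE => /orP[uA|uA] /orP[vA|vA] uv; auto.
    by case/orP: (noE u v uA vA uv) => ?; auto.
  rewrite adj_sym in uv.
  by case/orP: (noE v u vA uA uv) => ?; rewrite adj_sym in uv; auto.
- move=> v i j /splitI[hi|[i' hi ->]] /splitI[hj|[j' hj ->]].
  + by move=> /(topl _ _ hi) ti /(topl _ _ hj); apply: tB1.
  + move=> /(topl _ _ hi)/andP[vi _] /(topr _ _ hj)[_ /negP[]].
    by apply: (subsetP (sB1 _ hi)).
  + move=> /(topr _ _ hi)[_ /negP H] /(topl _ _ hj)/andP[vi _]; case: H.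
    by apply: (subsetP (sB1 _ hj)).
  + by move=> /(topr _ _ hi)[ti _] /(topr _ _ hj)[tj _]; rewrite (tB2 v i' j').
Qed.

End Glue.

Lemma subset_extend (T : finType) (A W : {set T}) m :
  W \subset A -> #|W| <= m <= #|A| ->
  exists W' : {set T}, [/\ W \subset W', W' \subset A & #|W'| = m].
Proof.
move=> sWA /andP[Wm mA].
have [W' /maxsetP[/andP[sA cm] mW] sW] :=
  @maxset_exists _ (fun S : {set T} => (S \subset A) && (#|S| <= m)) W (introT andP (conj sWA Wm)).
exists W'; split=> //; apply/eqP; rewrite eqn_leq cm leqNgt; apply/negP => lt.
have /subsetPn[x xA xW] : ~~ (A \subset W').
  by apply/negP => /subset_leq_card; lia.
have := mW (x |: W'); rewrite subUset sub1set xA sA subsetUr cardsU1 xW.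
by move=> /(_ lt isT)/setP/(_ x); rewrite in_setU1 eqxx (negPf xW).
Qed.

(** * From balanced sets to a tree decomposition *)

Section Separators.
Variables (G : sgraph) (d : nat).
Hypothesis sepG : forall w : G -> nat, exists2 Z : {set G}, #|Z| <= d & balanced setT w Z.

(** Enlarge [W] to a set [W'] of size 2d+1 and balance its counting weight by [Z]. A component [D]
    of [A :\: Z] has at most d vertices of [W'], so D with Z is decomposed recursively, with at most
    2d prescribed root vertices, and glued to the bag formed by [W'] and [Z]. *)
Lemma balanced_decomposable (A W : {set G}) :
  W \subset A -> #|W| <= (2 * d).+1 -> decomposable (3 * d).+1 A W.
Proof.
have half x : 2 * x <= (2 * d).+1 -> x <= d by lia.
have le3 : (2 * d).+1 + d <= (3 * d).+1 by lia.
have le2 : d + d <= (2 * d).+1 by lia.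
move: {-1}#|A|.+1 (ltnSn #|A|) => m; elim: m A W => // m IH A W cAm sWA cW.
case: (leqP #|A| (2 * d).+1) => cA.
  apply: decomposable_root sWA (decomposable_bag _).
  by apply: leq_trans cA (leq_trans (leq_addr d _) le3).
have [|W' [sWW sWA' cW']] := subset_extend (m := (2 * d).+1) sWA.
  by rewrite cW ltnW.
have [Z0 cZ0 balZ] := sepG (fun x => (x \in W') : nat).
have wE E : weight (fun x => (x \in W') : nat) E = #|W' :&: E|.
  rewrite /weight -sum1_card big_mkcond [RHS]big_mkcond /=.
  by apply: eq_bigr => x _; rewrite inE; case: (x \in W'); case: (x \in E).
pose Z := Z0 :&: A.
have sZA : Z \subset A by apply: subsetIr.
have cZ : #|Z| <= d by apply: leq_trans cZ0; rewrite subset_leq_card // subsetIl.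
pose A1 := W' :|: Z.
have cA1 : #|A1| <= (3 * d).+1.
  by apply: leq_trans (leq_card_setU W' Z) (leq_trans _ le3); rewrite cW' leq_add2l.
(* The components are attached one at a time: [U] ranges over the unions of components of
   [A :\: Z]. *)
suff H u : forall U : {set G}, #|U| <= u -> U \subset A :\: Z ->
    (forall x y, x \in U -> x \in A :\: Z -> y \in A :\: Z -> adj x y -> y \in U) ->
    decomposable (3 * d).+1 (A1 :|: U) A1.
  have := H _ (A :\: Z) (leqnn _) (subxx _) (fun x y _ _ yA _ => yA).
  have -> : A1 :|: A :\: Z = A.
    apply/eqP; rewrite eqEsubset !subUset sWA' sZA subsetDl /=.
    by apply/subsetP => x xA; rewrite !inE xA andbT; case: (x \in Z0); rewrite ?orbT.
  apply: decomposable_root; apply: subset_trans sWW _; exact: subsetUl.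
elim: u => [|u IHu] U cU sU clU.
  move: cU; rewrite leqn0 cards_eq0 => /eqP->; rewrite setU0.
  exact: decomposable_bag.
have [->|/set0Pn[x xU]] := eqVneq U set0.
  by rewrite setU0; apply: decomposable_bag.
have xA : x \in A :\: Z by apply: subsetP xU.
pose D := [set y | conn (A :\: Z) x y].
have DA : D \subset A :\: Z.
  by apply/subsetP => y; rewrite inE => /conn_mem; apply.
have DU : D \subset U.
  by apply/subsetP => y; rewrite inE => /conn_closed; apply.
have xD : x \in D by rewrite inE conn0.
have clD y z : y \in D -> z \in A :\: Z -> adj y z -> z \in D.
  move=> yD zA yz; move: (yD); rewrite !inE => xy; apply: conn_trans xy _.
  by apply: conn1 => //; apply: (subsetP DA).
have cD : connset D by apply: connset_component.
have dDZ0 : [disjoint D & Z0].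
  apply/pred0P => y /=; apply/negP => /andP[/(subsetP DA)].
  by rewrite !inE => /andP[/negP nZ yA] yZ; apply: nZ; rewrite yZ.
have cWD : #|W' :&: D| <= d.
  by have := balZ D cD (subsetT _) dDZ0; rewrite !wE setIT cW' => /half.
pose R := W' :&: D :|: Z.
have cR : #|R| <= d + d.
  by apply: leq_trans (leq_card_setU _ _) _; apply: leq_add.
have sRD : R \subset D :|: Z by apply: setSU; apply: subsetIr.
have decD : decomposable (3 * d).+1 (D :|: Z) R.
  apply: IH => //; last exact: leq_trans cR le2.
  apply: (@leq_trans #|A|) => //; apply: proper_card; rewrite properEneq; apply/andP; split; last first.
    by rewrite subUset sZA (subset_trans DA) // subsetDl.
  (* The recursion decreases: if D and Z filled [A], the 2d+1 vertices of [W'] would fit into [R],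
     which has at most 2d. *)
  apply/eqP => e; have : W' \subset R.
    apply/subsetP => y yW; have : y \in D :|: Z by rewrite e (subsetP sWA').
    by rewrite !in_setU !in_setI yW.
  move/subset_leq_card; rewrite cW' => /leq_trans/(_ cR).
  by rewrite addnn mul2n ltnn.
have decU : decomposable (3 * d).+1 (A1 :|: U :\: D) A1.
  apply: IHu.
  - rewrite -ltnS; apply: leq_trans cU; apply: proper_card; apply/properP; split; first exact: subsetDl.
    by exists x; rewrite // !inE conn0.
  - by apply: subset_trans sU; apply: subsetDl.
  - move=> y z; rewrite in_setD => /andP[yD yU] yA zA yz.
    rewrite in_setD (clU y z) // andbT; apply: contra yD => zD.
    by apply: clD zD _ _; rewrite // adj_sym.
have -> : A1 :|: U = (A1 :|: U :\: D) :|: (D :|: Z).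
  apply/setP => y; rewrite !in_setU in_setD.
  have := subsetP DU y; case: (y \in D); case: (y \in U) => //=; last first.
  - by rewrite !orbF -orbA orbb.
  - by move=> _; rewrite !orbT.
  - by move=> /(_ isT).
  - by rewrite !orbT.
apply: decomposable_glue decU decD _ _ _.
- rewrite /A1; apply/subsetP => y; rewrite !in_setI !in_setU in_setD.
  by case: (y \in Z); case: (y \in D); case: (y \in W'); rewrite ?orbT ?andbF.
- rewrite /R /A1; apply/subsetP => y; rewrite !in_setI !in_setU !in_setI in_setD.
  by case: (y \in Z0); case: (y \in A); case: (y \in D); case: (y \in W'); rewrite ?orbT ?andbF.
- move=> y z yA; rewrite [z \in _ :|: Z]in_setU => /orP[zD|zZ] yz; last first.
    by rewrite !in_setU zZ !orbT.
  case: (boolP (y \in Z)) => yZ; first by rewrite !in_setU yZ !orbT.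
  suff yD : y \in D by rewrite in_setU yD.
  apply: (clD z); rewrite 1?adj_sym // in_setD yZ /=.
  move: yA; rewrite !in_setU in_setD => /orP[/orP[/(subsetP sWA') //|]|/andP[_ yU]].
    exact: (subsetP sZA).
  by have := subsetP sU y yU; rewrite in_setD => /andP[].
Qed.

Lemma balanced_tw : (tw G <= (3 * d)%:Z)%R.
Proof.
apply: (@decomposable_tw _ _ set0); apply: balanced_decomposable.
  exact: sub0set.
by rewrite cards0.
Qed.

End Separators.

(** * Passing to the central bag *)

Section CentralBag.
Variable G : sgraph.
Implicit Types (b D E S Z : {set G}) (w : G -> nat) (L : seq {set G}).

(** For [S] inside [b] this says that [S] does not break [b :\: S] in [G]. The witness is any
    nonempty connected set, since it extends to a component. *)
Definition resolved b S : Prop :=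
  S \subset b -> exists D, [/\ D != set0, connset D,
    [disjoint D & closed_nbhd S] & b :\: S \subset closed_nbhd D].

(** Ensures that copies already treated stay settled when the bag shrinks further. *)
Lemma resolved_sub b b' S : b' \subset b -> resolved b S -> resolved b' S.
Proof.
move=> sb rS Sb'; have [D [D0 cD dD sD]] := rS (subset_trans Sb' sb).
by exists D; split=> //; apply: subset_trans sD; apply: setSD.
Qed.

(** The weight on [A] is not erased: in the application only sets disjoint from [A] are weighed
    afterwards. *)
Definition move_weight w (A : {set G}) x0 : G -> nat :=
  fun x => if x == x0 then w x + weight w A else w x.

Lemma move_weight_out w A x0 E :
  x0 \notin E -> weight (move_weight w A x0) E = weight w E.
Proof.
move=> x0E; apply: eq_bigr => x xE; rewrite /move_weight.
by case: eqVneq x0E => // <-; rewrite xE.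
Qed.

Lemma move_weight_in w A x0 E :
  x0 \in E -> weight (move_weight w A x0) E = weight w E + weight w A.
Proof.
move=> x0E; rewrite /weight (big_setD1 x0) //= [in RHS](big_setD1 x0) //=.
rewrite {1}/move_weight eqxx addnAC; congr (_ + _ + _).
by have := @move_weight_out w A x0 (E :\ x0); rewrite !inE eqxx; apply.
Qed.

Lemma move_weight_ge w A x0 E : weight w E <= weight (move_weight w A x0) E.
Proof.
case: (boolP (x0 \in E)) => x0E; first by rewrite move_weight_in // leq_addr.
by rewrite move_weight_out.
Qed.

(** A heavy connected set is enlarged to the full component of [b :\: Z] around it. *)
Lemma unbalanced_component b w Z :
  ~ balanced b w Z ->
  exists D, [/\ connset D, D \subset b :\: Z,
    (forall x y, x \in D -> y \in b :\: Z -> adj x y -> y \in D) &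
    weight w b < 2 * weight w D].
Proof.
move=> nb; have [E [cE Eb dE wE]] : exists E,
    [/\ connset E, E \subset b, [disjoint E & Z] & weight w b < 2 * weight w E].
  apply: contrapT => H; apply: nb => E cE Eb dE; rewrite leqNgt.
  by apply/negP => wE; apply: H; exists E.
have EbZ : E \subset b :\: Z by rewrite subsetD Eb.
have [e eE] : exists e, e \in E.
  apply/set0Pn; apply: contraTneq wE => ->.
  by rewrite /weight big_set0 muln0 -leqNgt.
have ebZ : e \in b :\: Z by apply: (subsetP EbZ).
pose D := [set y | conn (b :\: Z) e y].
have sD : D \subset b :\: Z.
  by apply/subsetP => y; rewrite inE => /conn_mem; apply.
exists D; split=> //.
- exact: connset_component.
- move=> x y xD yb xy; have xb := subsetP sD x xD.
  move: xD; rewrite !inE => /conn_trans; apply; exact: conn1.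
- apply: leq_trans wE _; rewrite leq_mul2l /=; apply: weightS.
  by apply/subsetP => y yE; rewrite inE; apply: conn_sub (cE e y eE yE).
Qed.

Section Lift.
Variables (b S D : {set G}) (w : G -> nat) (x0 : G).
Hypotheses (Sb : S \subset b) (cS : connset S) (x0S : x0 \in S).
Hypotheses (cD : connset D) (Db : D \subset b :\: closed_nbhd S).
Hypothesis clD : forall x y, x \in D -> y \in b :\: closed_nbhd S -> adj x y -> y \in D.
Hypothesis wD : weight w b < 2 * weight w D.

Let A := b :\: (closed_nbhd D :|: S).
Let b1 := b :\: A.
Let w1 := move_weight w A x0.

Lemma mem_central_bag x : x \in b1 -> x \in closed_nbhd D \/ x \in S.
Proof.
rewrite !in_setD in_setU => /andP[H xb]; move: H; rewrite xb andbT negbK.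
by case/orP; [left|right].
Qed.

Lemma sub_central_bag x : x \in b -> (x \in closed_nbhd D) || (x \in S) -> x \in b1.
Proof. by move=> xb H; rewrite /b1 !in_setD in_setU H xb. Qed.

Lemma central_bag_resolved : resolved b1 S.
Proof.
move=> _; exists D; split=> //.
- apply: contraTneq wD => ->.
  by rewrite /weight big_set0 muln0 -leqNgt.
- by move: Db; rewrite subsetD => /andP[].
- apply/subsetP => x; rewrite in_setD => /andP[xS /mem_central_bag[]] //.
  by rewrite (negPf xS).
Qed.

Let weight_b1 : weight w1 b1 = weight w b.
Proof.
rewrite /w1 move_weight_in; last first.
  by apply: sub_central_bag; [apply: (subsetP Sb)|rewrite x0S orbT].
rewrite /weight [RHS](big_setID A) /= addnC (setIidPr _) //.
exact: subsetDl.
Qed.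

(* If Z1 misses S, the removed part A hangs off the connected set formed by S
   and its neighbours, all in the component of x0; if Z1 meets S, then N[S] is
   added, and a component other than D is light because D is heavy. *)
Lemma balanced_lift Z1 :
  balanced b1 w1 Z1 ->
  balanced b w (if [disjoint S & Z1] then Z1 else Z1 :|: closed_nbhd S).
Proof.
move=> balZ E cE Eb; rewrite -weight_b1.
have in_b1 F : connset F -> F \subset b1 -> [disjoint F & Z1] ->
    2 * weight w F <= weight w1 b1.
  move=> cF Fb dF; apply: leq_trans (balZ F cF Fb dF).
  by rewrite leq_mul2l move_weight_ge.
case: ifP => dSZ dE; last first.
  have [dE1 dES] : [disjoint E & Z1] /\ [disjoint E & closed_nbhd S].
    by apply/andP; rewrite !disjoints_subset -subsetI -setCU -disjoints_subset.
  (* If [E] misses [D], which has more than half of the weight, [E] has less than half. Otherwise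
     [E], avoiding N[S], stays inside [D] and hence inside [b1]. *)
  have [dED|/pred0Pn[x /andP[/= xE xD]]] := boolP [disjoint E & D].
    have : weight w (E :|: D) <= weight w b.
      apply: weightS; rewrite subUset Eb (subset_trans Db) //; exact: subsetDl.
    rewrite weightU // weight_b1; move: wD.
    by move: (weight w E) (weight w D) (weight w b); clear; lia.
  apply: in_b1 => //; apply/subsetP => y yE.
  have yD : y \in D.
    have := cE x y xE yE; move/conn_closed; apply=> // u v uD uE vE uv.
    apply: (clD uD) uv; rewrite in_setD (subsetP Eb v vE) andbT.
    by move/pred0P: dES => /(_ v) /=; rewrite vE => /negbT.
  by apply: sub_central_bag; [exact: (subsetP Eb)|rewrite mem_closed_nbhd].
have [dEA|/pred0Pn[a /andP[/= aE aA]]] := boolP [disjoint E & A].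
  by apply: in_b1 => //; rewrite subsetD Eb.
(* The component of [x0] carries the weight moved from [A]; it remains to show that it contains
   [E :&: b1]. *)
pose E1 := [set y | conn (b1 :\: Z1) x0 y].
have Sb1 y : y \in S -> y \in b1 :\: Z1.
  move=> yS; rewrite in_setD sub_central_bag ?yS ?orbT ?(subsetP Sb) // andbT.
  by move/pred0P: dSZ => /(_ y) /=; rewrite yS => /negbT.
have SE1 y : y \in S -> y \in E1.
  move=> yS; rewrite inE; apply: conn_sub (cS x0S yS).
  by apply/subsetP => z; apply: Sb1.
have E1b : E1 \subset b1 :\: Z1.
  by apply/subsetP => y; rewrite inE => /conn_mem; apply; apply: Sb1.
have sEE1 : E :&: b1 \subset E1.
  apply/subsetP => y /setIP[yE yb1].
  have ab1 : a \notin b1 by rewrite in_setD aA.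
  (* Walk from [y] towards [a] until an edge [u v] leaves [b1]. Here [u] is not in [D], since [v] is
     outside N[D]; and a vertex of [b1] outside both [D] and N[S] does not exist. So [u] lies in
     N[S]. *)
  have [u [v [yu uEb vEb uv]]] := conn_exit (cE y a yE aE) yE yb1 ab1.
  have [uE ub1] := setIP uEb; have [vE vb1] := setDP vEb.
  have uZ : u \in b1 :\: Z1.
    rewrite in_setD ub1 andbT.
    by move/pred0P: dE => /(_ u) /=; rewrite uE => /negbT.
  have uE1 : u \in E1.
    have uD : u \notin D.
      apply: contra vb1 => uD; apply: sub_central_bag; first exact: (subsetP Eb).
      apply/orP; left; apply/closed_nbhdP; right; exists u => //.
      by rewrite adj_sym.
    case: (boolP (u \in S)) => uS; first exact: SE1.
    have /closed_nbhdP[/(negP uS) //|[s sS us]] : u \in closed_nbhd S.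
      apply: contraNT uD => uNS.
      case: (mem_central_bag ub1) => [/closed_nbhdP[//|[z zD uz]]|uS'].
        by apply: (clD zD); rewrite 1?adj_sym // in_setD uNS (subsetP Eb).
      by rewrite uS' in uS.
    move: (SE1 s sS); rewrite !inE => /conn_trans; apply.
    by apply: (conn1 (Sb1 s sS) uZ); rewrite adj_sym.
  move: uE1; rewrite !inE => /conn_trans; apply; rewrite conn_sym.
  apply: conn_sub yu; apply/subsetP => z /setIP[zE zb1]; rewrite in_setD zb1 andbT.
  by move/pred0P: dE => /(_ z) /=; rewrite zE => /negbT.
have cE1 : connset E1 by apply: connset_component; apply: Sb1.
have [E1b1 dE1] : E1 \subset b1 /\ [disjoint E1 & Z1].
  by move: E1b; rewrite subsetD => /andP[].
apply: leq_trans (balZ E1 cE1 E1b1 dE1); rewrite leq_mul2l /=.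
rewrite /w1 move_weight_in ?SE1 // -weightU; last first.
  rewrite -setI_eq0; apply/eqP/setP => y; rewrite !in_set0 in_setI.
  apply/negP => /andP[/(subsetP E1b1)]; rewrite in_setD => /andP[/negP nA _] yA.
  by apply: nA.
apply: weightS; apply/subsetP => y yE; rewrite in_setU.
case: (boolP (y \in A)) => yA; first by rewrite orbT.
by rewrite orbF; apply: (subsetP sEE1); rewrite in_setI yE in_setD yA (subsetP Eb).
Qed.

End Lift.
End CentralBag.

(** * Resolving one colour class after another *)

Section Rounds.
Variable G : sgraph.
Implicit Types (b D S Z : {set G}) (w : G -> nat) (L : seq {set G}).

(* The sets of L are far apart, so the N[S] added when undoing the step of S
   meets no other member of L: only the members meeting Z0 contribute. *)
Lemma balanced_resolve L s b w :
  uniq L -> {in L &, forall S S', S != S' -> [disjoint closed_nbhd S & S']} ->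
  {in L, forall S, S != set0 /\ connset S} -> 0 < s ->
  (forall b' w', b' \subset b -> {in L, forall S, resolved b' S} ->
     exists2 Z : {set G}, #|Z| <= s & balanced b' w' Z) ->
  exists Z0 Z : {set G}, [/\ #|Z0| <= s, balanced b w Z & forall z, z \in Z ->
    z \in Z0 \/ exists2 S, S \in L & ~~ [disjoint S & Z0] && (z \in closed_nbhd S)].
Proof.
move=> + + + s0; elim: L b w => [|S L IH] b w.
  move=> _ _ _ H; have [//|Z cZ bZ] := H b w (subxx b).
  by exists Z, Z; split=> // z; left.
rewrite cons_uniq => /andP[SL uL] farL cL H.
have subL S' : S' \in L -> S' \in S :: L by rewrite inE orbC => ->.
have [S0 cS] := cL S (mem_head S L).
have farL' : {in L &, forall S1 S2, S1 != S2 -> [disjoint closed_nbhd S1 & S2]}.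
  by move=> S1 S2 /subL m1 /subL m2; apply: farL.
have cL' : {in L, forall S', S' != set0 /\ connset S'} by move=> S' /subL /cL.
(* A set not contained in [b] is resolved vacuously in every subset of [b], so it is skipped. *)
have [Sb|nSb] := boolP (S \subset b); last first.
  have [|Z0 [Z [cZ0 bZ sZ]]] := IH b w uL farL' cL'.
    move=> b' w' sb' rL; apply: H => // S'; rewrite inE => /orP[/eqP-> Sb'|/rL //].
    by case/negP: nSb; apply: subset_trans Sb' sb'.
  exists Z0, Z; split=> // z /sZ[|[S' /subL ? ?]]; first by left.
  by right; exists S'.
have [x0 x0S] := set0Pn _ S0.
have [bal|/unbalanced_component[D [cD Db clD wD]]] :=
    pselect (balanced b w (closed_nbhd S)).
  (* [Z0] only has to meet [S], so one vertex suffices, and [0 < s] leaves room for it. *)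
  exists [set x0], (closed_nbhd S); split=> //; first by rewrite cards1.
  move=> z zS; right; exists S; first exact: mem_head.
  by rewrite zS andbT; apply/pred0Pn; exists x0; rewrite /= x0S inE eqxx.
set b1 := b :\: (b :\: (closed_nbhd D :|: S)).
set w1 := move_weight w (b :\: (closed_nbhd D :|: S)) x0.
have sb1 : b1 \subset b by apply: subsetDl.
have [|Z0 [Z1 [cZ0 bZ1 sZ1]]] := IH b1 w1 uL farL' cL'.
  move=> b' w' sb' rL; apply: H; first exact: subset_trans sb' sb1.
  move=> S'; rewrite inE => /orP[/eqP->|/rL //].
  apply: resolved_sub sb' _; apply: central_bag_resolved wD => //.
exists Z0, (if [disjoint S & Z1] then Z1 else Z1 :|: closed_nbhd S); split=> //.
  exact: (balanced_lift Sb cS x0S Db clD wD bZ1).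
have H1 z : z \in Z1 -> z \in Z0 \/
    exists2 S', S' \in S :: L & ~~ [disjoint S' & Z0] && (z \in closed_nbhd S').
  case/sZ1=> [|[S' /subL ? ?]]; first by left.
  by right; exists S'.
case: ifP => // /negbT/pred0Pn[y /andP[/= yS yZ1]] z; rewrite in_setU.
case/orP=> [/H1 //|zS]; right; exists S; first exact: mem_head.
rewrite zS andbT; apply/pred0Pn; exists y; rewrite /= yS /=.
(* The point [y] of [S] lies in no N[S'] with [S'] in [L], so it must come from [Z0]. *)
case: (sZ1 y yZ1) => // -[S' S'L /andP[_ yS']].
have : [disjoint closed_nbhd S' & S].
  by apply: farL; rewrite ?mem_head ?subL //; apply: contraNneq SL => <-.
by move/pred0P/(_ y); rewrite /= yS yS'.
Qed.

Lemma card_bigcup_le (I : finType) (T : finType) (A : {set I}) (K : I -> {set T}) g :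
  (forall i, i \in A -> #|K i| <= g) -> #|\bigcup_(i in A) K i| <= #|A| * g.
Proof.
move=> H; rewrite -sum_nat_const.
apply: (big_ind2 (fun (B : {set T}) n => #|B| <= n)); rewrite ?cards0 //.
move=> B1 n1 B2 n2 h1 h2; apply: leq_trans (leq_card_setU _ _) (leq_add h1 h2).
Qed.

(** Members of [L] are pairwise disjoint, so each point of [Z0] lies in at most one of them and
    accounts for at most one N[S], hence for at most [g] vertices. *)
Lemma balanced_class L s g b w :
  uniq L -> {in L &, forall S S', S != S' -> [disjoint closed_nbhd S & S']} ->
  {in L, forall S, [/\ S != set0, connset S & #|closed_nbhd S| <= g]} ->
  0 < s -> 0 < g ->
  (forall b' w', b' \subset b -> {in L, forall S, resolved b' S} ->
     exists2 Z : {set G}, #|Z| <= s & balanced b' w' Z) ->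
  exists2 Z : {set G}, #|Z| <= s * g & balanced b w Z.
Proof.
move=> uL farL cL s0 g0 H.
have [|Z0 [Z [cZ0 bZ sZ]]] := balanced_resolve w uL farL _ s0 H.
  by move=> S /cL[].
exists Z => //.
(* What the point [z] accounts for: N[S] for the member [S] containing it, and only itself if there
   is none. *)
pose K z := let i := find (fun S : {set G} => z \in S) L in
  if i < size L then closed_nbhd (nth set0 L i) else [set z].
have KP z : (exists S, [/\ S \in L, z \in S & K z = closed_nbhd S]) \/
    (forall S, S \in L -> z \notin S) /\ K z = [set z].
  rewrite /K -has_find; have [hz|hz] := ifPn.
    left; exists (nth set0 L (find (fun S : {set G} => z \in S) L)); split=> //.
      by rewrite mem_nth // -has_find.
    exact: (nth_find set0 hz).
  by right; split=> // S SL; apply: contra hz => zS; apply/hasP; exists S.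
apply: (@leq_trans #|\bigcup_(z in Z0) K z|); last first.
  apply: leq_trans (card_bigcup_le (g := g) _) _; last by rewrite leq_mul2r cZ0 orbT.
  move=> z _; case: (KP z) => [[S [/cL[_ _ cS] _ ->]]|[_ ->]] //.
  by rewrite cards1.
apply/subset_leq_card/subsetP => z /sZ[zZ0|[S SL /andP[/pred0Pn[y /andP[/= yS yZ0]] zS]]].
  apply/bigcupP; exists z => //.
  case: (KP z) => [[S [_ zS ->]]|[_ ->]]; first exact: mem_closed_nbhd.
  by rewrite inE.
apply/bigcupP; exists y => //; case: (KP y) => [[S' [S'L yS' ->]]|[nS _]]; last first.
  by have := nS S SL; rewrite yS.
have [<- //|neq] := eqVneq S S'.
have /pred0P/(_ y) := farL S S' SL S'L neq.
by rewrite /= yS' mem_closed_nbhd.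
Qed.

(** Colours below [i] are resolved first and colour [i] last, in the smaller bag. Undoing one colour
    costs a factor [g]. *)
Lemma balanced_rounds (P : {set {set G}}) (col : {set G} -> nat) g i s b w :
  {in P, forall S, [/\ S != set0, connset S & #|closed_nbhd S| <= g]} ->
  {in P &, forall S S', S != S' -> col S = col S' -> [disjoint closed_nbhd S & S']} ->
  0 < s -> 0 < g ->
  (forall b' w', b' \subset b -> (forall S, S \in P -> col S < i -> resolved b' S) ->
     exists2 Z : {set G}, #|Z| <= s & balanced b' w' Z) ->
  exists2 Z : {set G}, #|Z| <= s * g ^ i & balanced b w Z.
Proof.
move=> cP farP + g0; elim: i s b w => [|i IH] s b w s0 H.
  by rewrite expn0 muln1; apply: H.
rewrite expnS mulnA; apply: IH; first by rewrite muln_gt0 s0.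
move=> b1 w1 sb1 r1.
pose L := enum [set S in P | col S == i].
have LP S : S \in L -> S \in P /\ col S = i.
  by rewrite mem_enum inE => /andP[? /eqP].
apply: (@balanced_class L) => //.
- exact: enum_uniq.
- move=> S S' /LP[SP eS] /LP[SP' eS'] ne; apply: farP => //.
  by rewrite eS eS'.
- by move=> S /LP[/cP].
move=> b2 w2 sb2 r2; apply: H; first exact: subset_trans sb2 sb1.
move=> S SP; rewrite ltnS leq_eqVlt => /orP[/eqP e|lt].
  by apply: r2; rewrite mem_enum inE SP e eqxx.
by apply: resolved_sub sb2 _; apply: r1.
Qed.

End Rounds.

(** * Counting and colouring the copies *)

Section Counting.
Variable G : sgraph.
Implicit Types (S : {set G}) (v x y : G).

Lemma card_nbrs v : #|[set u | adj v u]| <= max_degree G.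
Proof. exact: leq_bigmax_cond. Qed.

(** In a connected set every vertex other than [v] has a neighbour in the set, so N[S] consists of
    neighbours of [S] and possibly [v]. *)
Lemma card_closed_nbhd S v :
  connset S -> v \in S -> #|closed_nbhd S| <= 1 + #|S| * max_degree G.
Proof.
move=> cS vS; pose U := \bigcup_(x in S) [set u | adj x u].
have sU : closed_nbhd S \subset v |: U.
  apply/subsetP => x /closed_nbhdP[xS|[y yS xy]]; rewrite in_setU1.
    have [//|neq] := eqVneq x v.
    have [y xy [yS _]] := conn_avoid (cS x v xS vS) neq.
    by apply/bigcupP; exists y; rewrite // inE adj_sym.
  by apply/orP; right; apply/bigcupP; exists y; rewrite // inE adj_sym.
apply: leq_trans (subset_leq_card sU) _; rewrite cardsU1.
apply: leq_add; first exact: leq_b1.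
by apply: card_bigcup_le => x _; apply: card_nbrs.
Qed.

(** Each new vertex [s] is visited by a detour from a neighbour [r] on the walk and back, at the
    price of two steps. *)
Lemma covering_walk S v j :
  connset S -> v \in S -> j < #|S| ->
  exists p, [/\ path (@adj G) v p, size p = 2 * j, {subset v :: p <= S} &
    j < #|[set x in v :: p]|].
Proof.
move=> cS vS; elim: j => [|j IH] jS.
  exists [::]; split=> // [x|].
    by rewrite inE => /eqP->.
  by apply/card_gt0P; exists v; rewrite !inE.
have [p [pP sp pS cp]] := IH (ltnW jS).
have sR : [set x in v :: p] \subset S.
  by apply/subsetP => x; rewrite inE; apply: pS.
have [r [s [rp sS rs H]]] : exists r s, [/\ r \in v :: p, s \in S, adj r s &
    j.+1 < #|s |: [set x in v :: p]|].
  (* If the walk covers [S] already, a detour from [v] to a neighbour in [S] keeps the length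
     exact. *)
  have [e|ne] := eqVneq [set x in v :: p] S.
    have [y yS yv] : exists2 y, y \in S & y != v.
      have : 0 < #|S :\ v| by move: jS; rewrite (cardsD1 v) vS; lia.
      by case/card_gt0P => y; rewrite !inE => /andP[? ?]; exists y.
    have vv : v \in [set v] by rewrite inE.
    have yv' : y \notin [set v] by rewrite inE.
    have [r [s [_ /setIP[_ rv] /setDP[sS _] rs]]] := conn_exit (cS v y vS yS) vS vv yv'.
    exists r, s; split=> //; first by rewrite inE (set1P rv) eqxx.
    by apply: (leq_trans jS); rewrite e subset_leq_card // subsetUr.
  have /subsetPn[y yS yR] : ~~ (S \subset [set x in v :: p]).
    by apply: contra ne => ?; rewrite eqEsubset sR.
  have vR : v \in [set x in v :: p] by rewrite !inE eqxx.
  have [r [s [_ /setIP[_ rR] /setDP[sS sR'] rs]]] := conn_exit (cS v y vS yS) vS vR yR.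
  exists r, s; split=> //; first by rewrite inE in rR.
  by rewrite cardsU1 sR'.
case: (splitPl rp) pP sp pS H {IH sR cp} => p1 p2 lp1.
rewrite cat_path size_cat lp1 => /andP[P1 P2] sp pS H.
exists (p1 ++ s :: r :: p2); split.
- by rewrite cat_path /= lp1 P1 rs adj_sym rs.
- by rewrite size_cat /=; lia.
- move=> x; rewrite !inE mem_cat !inE.
  have rS : r \in S by apply: pS; rewrite -lp1 -cat_cons mem_cat mem_last.
  have := pS x; rewrite inE mem_cat.
  case: (x == v) => [/(_ isT) //|] /=; case: (x \in p1) => [/(_ isT) //|] /=.
  by case: eqVneq => [-> //|_]; case: eqVneq => [-> //|_].
- apply: leq_trans H _; apply/subset_leq_card/subsetP => x.
  rewrite !inE !mem_cat !inE.
  by case: (x == v); case: (x == s); case: (x \in p1); case: (x \in p2); rewrite ?orbT.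
Qed.

Fixpoint walks n v : seq (seq G) :=
  if n is m.+1 then [seq u :: p | u <- enum [set u | adj v u], p <- walks m u]
  else [:: [::]].

Lemma size_walks n v : size (walks n v) <= max_degree G ^ n.
Proof.
elim: n v => [|n IH] v //=.
rewrite size_allpairs_dep expnS; apply: (@leq_trans (\sum_(u <- enum [set u | adj v u]) max_degree G ^ n)).
  rewrite sumnE big_map; apply: leq_sum => u _; exact: IH.
by rewrite big_const_seq count_predT iter_addn_0 -cardE mulnC leq_mul2r card_nbrs orbT.
Qed.

Lemma mem_walks v p : path (@adj G) v p -> p \in walks (size p) v.
Proof.
elim: p v => [|u p IH] v //= /andP[vu pP].
by apply/allpairsPdep; exists u, p; rewrite mem_enum inE vu IH.
Qed.

(** Such a set is the vertex set of a covering walk from [v] with 2k steps, so counting walks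
    suffices. *)
Lemma card_connset_at (P : {set {set G}}) k v :
  {in P, forall S, connset S /\ #|S| = k.+1} ->
  #|[set S in P | v \in S]| <= max_degree G ^ (2 * k).
Proof.
move=> cP; apply: leq_trans (size_walks (2 * k) v).
pose s := [seq [set x in v :: p] | p <- walks (2 * k) v].
rewrite -(size_map (fun p => [set x in v :: p])) -/s.
apply: leq_trans (card_size s); apply/subset_leq_card/subsetP => S.
rewrite inE => /andP[/cP[cS kS] vS].
have [|p [pP sp pS cp]] := @covering_walk S v k cS vS; first by rewrite kS.
apply/mapP; exists p; first by rewrite -sp mem_walks.
apply/eqP; rewrite eq_sym eqEcard kS cp andbT.
by apply/subsetP => x; rewrite inE; apply: pS.
Qed.

(** Every set in conflict with [S] passes through one of the vertices of N[S]. *)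
Lemma card_conflicts (P : {set {set G}}) k S :
  {in P, forall S, connset S /\ #|S| = k.+1} -> S \in P ->
  #|[set S' in P | ~~ [disjoint closed_nbhd S & S']]|
    <= (1 + k.+1 * max_degree G) * max_degree G ^ (2 * k).
Proof.
move=> cP SP; have [cS kS] := cP S SP.
have [v vS] : exists v, v \in S by apply/card_gt0P; rewrite kS.
apply: (@leq_trans #|\bigcup_(z in closed_nbhd S) [set S' in P | z \in S']|).
  apply/subset_leq_card/subsetP => S'; rewrite inE => /andP[S'P].
  by case/pred0Pn=> z /andP[/= zN zS']; apply/bigcupP; exists z; rewrite // inE S'P.
apply: leq_trans (card_bigcup_le (fun z _ => card_connset_at z cP)) _.
by rewrite leq_mul2r -kS (card_closed_nbhd cS vS) orbT.
Qed.

End Counting.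

(** The at most [m] elements related to [x] leave one of the m+1 colours free for [x]. *)
Lemma greedy_colouring (T : finType) (e : rel T) (P : {set T}) m :
  symmetric e -> {in P, forall x, #|[set y in P | e x y]| <= m} ->
  exists c : T -> 'I_m.+1, {in P &, forall x y, x != y -> c x = c y -> ~~ e x y}.
Proof.
move=> e_sym; move: {2}#|P| (leqnn #|P|) => n; elim: n P => [|n IH] P cP dP.
  exists (fun _ => ord0) => x y xP; move: cP; rewrite leqn0 cards_eq0 => /eqP P0.
  by rewrite P0 inE in xP.
have [P0|/set0Pn[x xP]] := eqVneq P set0.
  by exists (fun _ => ord0) => x y; rewrite P0 inE.
have sP : P :\ x \subset P by apply: subsetDl.
have [|y /(subsetP sP)/dP|c cc] := IH (P :\ x).
- by move: cP; rewrite (cardsD1 x) xP.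
- apply: leq_trans; apply/subset_leq_card/subsetP => z.
  by rewrite !inE => /andP[/andP[_ ->] ->].
have [i iN] : exists i, i \notin [set c y | y in [set y in P | e x y]].
  apply/existsP; rewrite -negb_forall; apply/negP => /forallP H.
  have : #|'I_m.+1| <= #|[set c y | y in [set y in P | e x y]]|.
    by apply/subset_leq_card/subsetP => i _; apply: H.
  rewrite card_ord leqNgt => /negP[]; rewrite ltnS.
  exact: leq_trans (leq_imset_card _ _) (dP x xP).
have iN' y : y \in P -> e x y -> i != c y.
  move=> yP xy; apply: contraNneq iN => ->.
  by apply/imsetP; exists y; rewrite // inE yP.
exists (fun y => if y == x then i else c y) => y z yP zP.
case: (eqVneq y x) => [->|yx]; case: (eqVneq z x) => [->|zx]; rewrite ?eqxx // => ne.
- by move=> ic; apply/negP => /(iN' z zP); rewrite ic eqxx.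
- by move=> ci; rewrite e_sym; apply/negP => /(iN' y yP); rewrite ci eqxx.
- by apply: cc; rewrite // !inE ?yx ?zx.
Qed.

(** * The bound *)

Lemma isomorphic_sym (G H : sgraph) : isomorphic G H -> isomorphic H G.
Proof.
case=> f [g fK gK] fm; exists g; first by exists f.
by move=> x y; rewrite -fm !gK.
Qed.

Lemma isomorphic_trans (G H K : sgraph) :
  isomorphic G H -> isomorphic H K -> isomorphic G K.
Proof.
case=> f fb fm [g gb gm]; exists (g \o f); first exact: bij_comp.
by move=> x y /=; rewrite gm fm.
Qed.

Lemma isomorphic_card (G H : sgraph) : isomorphic G H -> #|G| = #|H|.
Proof. by case=> f /bij_eq_card. Qed.

Lemma isomorphic_connected (G H : sgraph) : isomorphic G H -> connected H -> connected G.
Proof.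
move=> iGH /andP[H0 /forallP cH]; rewrite /connected (isomorphic_card iGH) H0 /=.
case: iGH => f [g fK gK] fm.
suff cg z z' : connect (@adj H) z z' -> connect (@adj G) (g z) (g z').
  apply/forallP => x; apply/forallP => y; rewrite -[x]fK -[y]fK.
  by apply: cg; move/forallP: (cH (f x)); apply.
move=> /connectP[p + ->]; elim: p z => //= u p IH z /andP[zu pP].
by apply: connect_trans (IH u pP); apply: connect1; rewrite -fm !gK.
Qed.

Lemma card_induced (G : sgraph) (S : {set G}) : #|induced S| = #|S|.
Proof. by rewrite card_sig; apply: eq_card => x; rewrite inE. Qed.

Section InducedInduced.
Variables (G : sgraph) (b : {set G}).

Lemma isomorphic_induced (S : {set induced b}) :
  isomorphic (induced ((val : induced b -> G) @: S)) (induced S).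
Proof.
pose g (z : induced S) : induced ((val : induced b -> G) @: S) :=
  exist _ (val (val z)) (imset_f val (valP z)).
apply: isomorphic_sym; exists g => //.
have gi : injective g.
  by move=> x y [] e; apply: val_inj; apply: val_inj.
by apply: inj_card_bij => //; rewrite !card_induced card_imset //; apply: val_inj.
Qed.

Lemma weight_induced w (E : {set G}) : E \subset b ->
  weight (fun x : induced b => w (val x)) [set x : induced b | val x \in E] = weight w E.
Proof.
move=> Eb; rewrite -[in RHS](_ : (val : induced b -> G) @: [set x | val x \in E] = E).
  by rewrite /weight big_imset //= => x y _ _; apply: val_inj.
apply/setP => x; apply/imsetP/idP => [[y + ->]|xE]; first by rewrite inE.
by exists (exist _ x (subsetP Eb x xE)); rewrite ?inE.
Qed.

Lemma connset_induced (E : {set G}) : E \subset b -> connset E ->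
  connset [set x : induced b | val x \in E].
Proof.
move=> Eb cE x y; rewrite !inE => xE yE; set E' := [set x | _].
pose C := [set z | [forall u : induced b, (val u == z) ==> conn E' x u]].
suff : val y \in C by rewrite inE => /forallP/(_ y)/implyP; apply.
apply: conn_closed (cE _ _ xE yE) _; last first.
  rewrite inE; apply/forallP => u; apply/implyP => /eqP/val_inj->; exact: conn0.
move=> u v; rewrite !inE => /forallP uC uE vE uv.
apply/forallP => z; apply/implyP => /eqP zv.
have := uC (exist _ u (subsetP Eb u uE)); rewrite /= eqxx /= => /conn_trans; apply.
by apply: conn1; rewrite ?inE ?zv //=; move: uv; rewrite -zv.
Qed.

Lemma balanced_induced n : (tw (induced b) < n%:Z)%R ->
  forall w, exists2 Z : {set G}, #|Z| <= n & balanced b w Z.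
Proof.
move=> twb w; have [Z cZ bZ] := tw_balanced (fun x : induced b => w (val x)) twb.
exists ((val : induced b -> G) @: Z); first by rewrite card_imset //; apply: val_inj.
move=> E cE Eb dE.
have := bZ _ (connset_induced Eb cE) (subsetT _).
rewrite weight_induced // -[weight w b]weight_induced //.
rewrite (_ : [set x : induced b | val x \in b] = setT); last first.
  by apply/setP => x; rewrite !inE (valP x).
apply; apply/pred0P => x /=; apply/negP => /andP[]; rewrite inE => xE xZ.
by move/pred0P/(_ (val x)): dE; rewrite /= xE imset_f.
Qed.

End InducedInduced.

Lemma forcer_card (G K X : sgraph) (Y : {set G}) :
  0 < #|X| -> forcer X K G -> isomorphic (induced Y) K -> 1 < #|Y|.
Proof.
move=> X0 fK /fK[X' [/proper_card pX iX _]]; apply: leq_ltn_trans pX.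
by rewrite -card_induced (isomorphic_card iX).
Qed.

(** A copy [Y] of a member of [F] inside [b] would contain a copy [X'] of [X] breaking [Y :\: X'].
    But the witness that [X'] is resolved extends to a component whose closed neighbourhood contains
    [b :\: X']. *)
Lemma graph_free_resolved (G X : sgraph) (F : sgraph -> Prop) (b : {set G}) :
  (forall K, F K -> forcer X K G) ->
  (forall S, isomorphic (induced S) X -> resolved b S) ->
  graph_free F (induced b).
Proof.
move=> fX rb K S FK /(isomorphic_trans (isomorphic_induced S)).
set Y := _ @: S => iY; have [X' [/proper_sub sX iX brX]] := fX K FK Y iY.
have Yb : Y \subset b by apply/subsetP => x /imsetP[y _ ->]; apply: (valP y).
have [D [D0 cD dD sD]] := rb X' iX (subset_trans sX Yb).
have pD : (D \subset ~: closed_nbhd X') && connected (induced D).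
  by rewrite -disjoints_subset dD; apply/connected_inducedP.
have [D' mD' sD'] :=
  @maxset_exists _ (fun A : {set G} => (A \subset ~: closed_nbhd X') && connected (induced A)) D pD.
move/negP: (brX D' mD'); apply.
apply: subset_trans (closed_nbhdS sD'); apply: subset_trans sD.
exact: setSD.
Qed.

Lemma gamma_ge Delta x : 1 + x * Delta <= gamma Delta x.
Proof.
elim: x => [|x IH]; first by rewrite /gamma big_ord1.
rewrite /gamma big_ord_recr /= -/(gamma Delta x) mulSn addnCA addnC leq_add //.
by case: Delta {IH} => // D; rewrite -{1}[D.+1]expn1 leq_pexp2l.
Qed.

Section Bound.
Variables (Delta : nat) (C : sgraph -> Prop) (t : nat) (X : sgraph) (F : sgraph -> Prop).
Hypotheses (hDelta : 0 < Delta) (hdeg : forall G, C G -> max_degree G <= Delta) (hher : hereditary C).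
Hypotheses (hX : connected X) (hXt : #|X| < t).
Hypothesis hF : forall K, F K -> class_forcer X K C.

(** A copy of [X] has at most t-1 vertices, so [g] bounds its closed neighbourhood. Its covering
    walks have at most 2(t-2) steps, so [m] bounds the number of copies in conflict with a given
    one. *)
Let g := 1 + t.-1 * Delta.
Let m := g * Delta ^ (2 * t.-2).

(** With [m.+1] colours, all copies of [X] are resolved in as many rounds. The final bag is
    [F]-free, which gives the initial size [n]. *)
Lemma class_balanced n (G : sgraph) (w : G -> nat) :
  0 < n -> C G ->
  (forall H, C H -> graph_free F H -> (tw H < n%:Z)%R) ->
  exists2 Z : {set G}, #|Z| <= n * g ^ m.+1 & balanced setT w Z.
Proof.
move=> n0 CG htw.
have X0 : 0 < #|X| by case/andP: hX.
have dG := hdeg CG.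
pose P := [set S : {set G} | `[< isomorphic (induced S) X >]].
have PP S : S \in P -> [/\ S != set0, connset S & #|S| = #|X|].
  rewrite inE => /asboolP iS.
  have /connected_inducedP[S0 cS] := isomorphic_connected iS hX.
  by split=> //; rewrite -(isomorphic_card iS) card_induced.
have kt : #|X|.-1 <= t.-2 by lia.
have gP S : S \in P -> [/\ S != set0, connset S & #|closed_nbhd S| <= g].
  move=> /PP[S0 cS kS]; split=> //; have [v vS] := set0Pn _ S0.
  apply: leq_trans (card_closed_nbhd cS vS) _.
  by rewrite leq_add2l leq_mul // kS; lia.
pose e := [rel S S' : {set G} | ~~ [disjoint closed_nbhd S & S']].
have e_sym : symmetric e.
  suff H S S' : e S S' -> e S' S by move=> S S'; apply/idP/idP; apply: H.
  move=> /pred0Pn[z /andP[/= /closed_nbhdP zS zS']]; apply/pred0Pn.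
  case: zS => [zS|[y yS zy]].
    by exists z; rewrite /= zS mem_closed_nbhd.
  exists y; rewrite /= yS andbT; apply/closed_nbhdP; right; exists z => //.
  by rewrite adj_sym.
have [S SP|col colP] := @greedy_colouring _ e P m e_sym.
  apply: leq_trans (@card_conflicts _ P #|X|.-1 S _ SP) _.
    by move=> S' /PP[_ ? ->]; rewrite prednK.
  rewrite /m /g prednK //; apply: leq_mul.
    by rewrite leq_add2l leq_mul //; lia.
  apply: (@leq_trans (Delta ^ (2 * #|X|.-1))); last by rewrite leq_pexp2l // leq_mul2l kt.
  by case: (2 * #|X|.-1) => // i; rewrite leq_exp2r.
apply: (@balanced_rounds G P (fun S => col S) g m.+1 n setT w gP) => //.
- move=> S S' SP SP' ne /val_inj ec.
  by have := colP S S' SP SP' ne ec; rewrite negbK.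
move=> b w' _ rb; apply: balanced_induced; apply: htw; first exact: hher.
apply: (graph_free_resolved (X := X)) => [K FK|S iS]; first exact: hF _ FK _ CG.
by apply: rb; rewrite ?ltn_ord // inE; apply/asboolP.
Qed.

End Bound.

Lemma tw_ge0 (G : sgraph) (v : G) : (0 <= tw G)%R.
Proof.
rewrite /tw; case: ex_minnP => k /asboolP[T [B [[_ cB _ _] <-]]] _.
have [t vt] := cB v.
have Bt : 0 < #|B t| by apply/card_gt0P; exists v.
have : #|B t| <= \max_(t : T) #|B t| by apply: leq_bigmax_cond.
lia.
Qed.

(** A copy of a forcer contains a nonempty proper subset, so it has at least two vertices. *)
Lemma small_graph_free (G X : sgraph) (F : sgraph -> Prop) (b : {set G}) :
  0 < #|X| -> (forall K, F K -> forcer X K G) -> #|b| <= 1 ->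
  graph_free F (induced b).
Proof.
move=> X0 fX cb K S FK /(isomorphic_trans (isomorphic_induced S)).
move/(forcer_card X0 (fX K FK)); rewrite ltnNge card_imset; last exact: val_inj.
by rewrite (leq_trans (max_card _)) // card_induced.
Qed.

Theorem theorem2p10 (Delta : nat) (hDelta : 0 < Delta)
    (C : sgraph -> Prop)
    (hdeg : forall G : sgraph, C G -> max_degree G <= Delta)
    (hher : hereditary C)
    (t : nat) (N : int) (X : sgraph)
    (hXconn : connected X) (hXcard : #|X| < t)
    (F : sgraph -> Prop)
    (hF : forall K : sgraph, F K -> class_forcer X K C)
    (htw : forall H : sgraph, C H -> graph_free F H -> (tw H < N)%R) :
  forall G : sgraph, C G ->
    (tw G <= 2 * N *
       (gamma Delta (t + 1)
          ^ (Delta ^ (t ^ 2) * gamma Delta (2 * t) + 1))%N%:Z)%R.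
Proof.
move=> G CG.
have X0 : 0 < #|X| by case/andP: hXconn.
have t2 : 1 < t by apply: leq_ltn_trans hXcard.
have free_small (b : {set G}) : #|b| <= 1 -> (tw (induced b) < N)%R.
  move=> cb; apply: htw; first exact: hher.
  by apply: (small_graph_free X0) => // K FK; apply: hF.
set M := Delta ^ (t ^ 2) * gamma Delta (2 * t).
set p := gamma Delta (t + 1).
have p2 : 2 <= p.
  apply: leq_trans (gamma_ge _ _); rewrite ltnS muln_gt0 hDelta; lia.
(* The null graph is [F]-free and treewidth is at least -1, so [N] is nonnegative. *)
have [n eN] : exists n : nat, N = (n%:Z)%R.
  have : (-1 <= tw (induced (set0 : {set G})))%R by rewrite /tw; lia.
  have := free_small set0; rewrite cards0 => /(_ isT) h1 h2.
  by exists `|N|%N; lia.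
(* If [N] is 0, single vertices, of treewidth at least 0, are excluded. So [G] is null and itself
   [F]-free. *)
subst N; have [n0|n_gt0] := posnP n.
  have G0 : #|G| = 0.
    apply/eqP; rewrite -leqn0 leqNgt; apply/negP => /card_gt0P[v _].
    have := free_small [set v]; rewrite cards1 => /(_ isT).
    have /tw_ge0 : induced [set v] by exists v; rewrite inE.
    by rewrite n0; lia.
  have : (tw G < n%:Z)%R.
    apply: htw => // K S FK iS; have := forcer_card X0 (hF _ FK _ CG) iS.
    by rewrite ltnNge (leq_trans (max_card _)) // G0.
  by rewrite n0; lia.
have sep w := class_balanced hDelta hdeg hher hXconn hXcard hF w n_gt0 CG htw.
set g := 1 + t.-1 * Delta in sep; set m := g * Delta ^ (2 * t.-2) in sep.
have gp : g <= p.
  by apply: leq_trans (gamma_ge _ _); rewrite leq_add2l leq_mul2r; apply/orP; right; lia.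
(* Here g is less than gamma(2t), and 2(t-2) is at most the square of t. The strict inequality pays
   for the extra colour in [m.+1]. *)
have mM : m < M.
  have gl : g < gamma Delta (2 * t).
    by apply: leq_trans (gamma_ge _ _); rewrite ltn_add2l ltn_mul2r hDelta /=; lia.
  apply: (@leq_trans (gamma Delta (2 * t) * Delta ^ (2 * t.-2))).
    by rewrite ltn_mul2r expn_gt0 hDelta.
  by rewrite mulnC leq_mul2r leq_pexp2l ?orbT //; nia.
(* The factor 3 comes from [balanced_tw]; the extra 1 in the exponent supplies a factor [p] at least
   2, and 3 is at most 2p. *)
have bound : 3 * (n * g ^ m.+1) <= 2 * n * p ^ (M + 1).
  have le1 : g ^ m.+1 <= p ^ M.
    apply: (@leq_trans (p ^ m.+1)); first by rewrite leq_exp2r.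
    by rewrite leq_pexp2l // (leq_trans _ p2).
  rewrite expnD expn1 [leqLHS]mulnCA [2 * n]mulnC -mulnA leq_mul2l; apply/orP; right.
  apply: leq_trans (leq_mul (leqnn 3) le1) _.
  by rewrite [leqRHS]mulnCA [leqLHS]mulnC leq_mul2l; apply/orP; right; lia.
have := balanced_tw sep; move: bound.
by move: (g ^ m.+1) (p ^ (M + 1)) (tw G); clear; lia.
Qed.
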